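(* There exists $n_0$ such that for every integer $n \ge n_0$ there is a body $M \subset \mathbb{R}^n$ of constant width $2$ with $\mathrm{Vol}(M) < 0.9^n \, \mathrm{Vol}(\mathbb{B}^n)$.
   Context: $\mathbb{B}^n$ is the closed Euclidean unit ball in $\mathbb{R}^n$, and $\mathrm{Vol}$ is $n$-dimensional volume (Lebesgue measure). A convex body in $\mathbb{R}^n$ is a compact convex set with nonempty interior. A convex body $K\subset\mathbb{R}^n$ has constant width $w$ if the length of the orthogonal projection of $K$ onto any line is equal to $w$. *)

(* Defs.v *)
From HB Require Import structures.
From mathcomp Require Import all_boot all_order all_algebra.
From mathcomp Require Import all_classical all_reals all_analysis.

Set Implicit Arguments.
Unset Strict Implicit.
Unset Printing Implicit Defensive.

Import Order.TTheory GRing.Theory Num.Theory.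
Import numFieldNormedType.Exports.

Local Open Scope classical_set_scope.
Local Open Scope ring_scope.

(* The library norm `|x| on 'rV[R]_n is the sup norm, so
   the Euclidean norm is defined here; both induce the library topology. *)
Definition dotp (R : realType) (n : nat) (x y : 'rV[R]_n) : R :=
  \sum_(i < n) x 0 i * y 0 i.

Definition enorm (R : realType) (n : nat) (x : 'rV[R]_n) : R :=
  Num.sqrt (dotp x x).

Definition eball (R : realType) (n : nat) : set 'rV[R]_n :=
  [set x | enorm x <= 1].

Definition convex_body (R : realType) (n : nat) (K : set 'rV[R]_n) : Prop :=
  [/\ compact K, convex_set K & K° !=set0].

(* For a unit vector u, [line p u] is the unit-speed parametrization of the
   line through p with direction u. *)
Definition line (R : realType) (n : nat) (p u : 'rV[R]_n) (t : R) : 'rV[R]_n :=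
  p + t *: u.

Definition orth_proj (R : realType) (n : nat) (p u x : 'rV[R]_n) : 'rV[R]_n :=
  p + dotp (x - p) u *: u.

(* Length of the part of S lying on the line through p with unit direction u. *)
Definition length_on_line (R : realType) (n : nat) (p u : 'rV[R]_n)
    (S : set 'rV[R]_n) : \bar R :=
  lebesgue_measure (line p u @^-1` S).

Definition constant_width (R : realType) (n : nat) (w : R)
    (K : set 'rV[R]_n) : Prop :=
  forall p u : 'rV[R]_n, enorm u = 1 ->
    length_on_line p u (orth_proj p u @` K) = w%:E.

Section LebesgueTuple.
Context (R : realType).
Local Notation mR := (measurableTypeR R).

Definition cons_pair (n : nat) (p : mR * n.-tuple mR) : n.+1.-tuple mR :=
  [the n.+1.-tuple mR of p.1 :: p.2].

Lemma measurable_cons_pair (n : nat) :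
  measurable_fun [set: mR * n.-tuple mR] (@cons_pair n).
Proof. exact: measurable_cons. Qed.

Section Step.
Context (n : nat) (m : {sigma_finite_measure set (n.-tuple mR) -> \bar R}).

Definition lebesgue_step : set (n.+1.-tuple mR) -> \bar R :=
  pushforward (lebesgue_measure \x m)%E (@cons_pair n).

Let step0 : lebesgue_step set0 = 0%E.
Proof. by rewrite /lebesgue_step /pushforward preimage_set0 measure0. Qed.

Let step_ge0 A : (0 <= lebesgue_step A)%E.
Proof. by rewrite /lebesgue_step /pushforward; exact: measure_ge0. Qed.

Let step_sigma_additive : semi_sigma_additive lebesgue_step.
Proof.
move=> F mF tF mUF; rewrite /lebesgue_step /pushforward preimage_bigcup.
have mpre B : measurable B -> measurable (@cons_pair n @^-1` B).
  by move=> mB; rewrite -[X in measurable X]setTI; exact: measurable_cons_pair.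
apply: measure_semi_sigma_additive.
- by move=> k; exact: mpre.
- apply/trivIsetP => /= i j _ _ ij; rewrite -preimage_setI.
  by move/trivIsetP : tF => /(_ _ _ _ _ ij) ->//; rewrite preimage_set0.
- by rewrite -preimage_bigcup; exact: mpre.
Qed.

HB.instance Definition _ := isMeasure.Build _ _ _ lebesgue_step
  step0 step_ge0 step_sigma_additive.

Let step_sigma_finite : sigma_finite setT lebesgue_step.
Proof.
have /sigma_finiteP[F [TF ndF Foo]] := sigma_finiteT (@lebesgue_measure R).
have /sigma_finiteP[G [TG ndG Goo]] := sigma_finiteT m.
pose hd (t : n.+1.-tuple mR) : mR := tnth t ord0.
pose tl (t : n.+1.-tuple mR) : n.-tuple mR := [tuple of behead t].
exists (fun k => hd @^-1` F k `&` tl @^-1` G k).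
  apply/esym; rewrite -subTset => t _.
  have [i _ Fi] : (\bigcup_i F i) (hd t) by rewrite -TF.
  have [j _ Gj] : (\bigcup_i G i) (tl t) by rewrite -TG.
  exists (maxn i j) => //; split => /=.
  - by move: Fi; exact/subsetPset/ndF/leq_maxl.
  - by move: Gj; exact/subsetPset/ndG/leq_maxr.
move=> k; have [mF Fk] := Foo k; have [mG Gk] := Goo k; split.
  apply: measurableI.
    by rewrite -[X in measurable X]setTI; exact: measurable_tnth.
  by rewrite -[X in measurable X]setTI; exact: measurable_behead.
rewrite /lebesgue_step /pushforward.
rewrite (_ : _ @^-1` _ = F k `*` G k).
  by rewrite product_measure1E// lte_mul_pinfty// ge0_fin_numE.
have E p : tl (cons_pair p) = p.2 by exact/val_inj.
by apply/seteqP; split => p [Fp]; rewrite /preimage /= E.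
Qed.

HB.instance Definition _ := Measure_isSigmaFinite.Build _ _ _ lebesgue_step
  step_sigma_finite.

End Step.

(* n-dimensional Lebesgue measure on n-tuples, with the product sigma-algebra
   (i.e. the Borel sets of R^n): the n-fold product of the one-dimensional
   Lebesgue measure. *)
Fixpoint lebesgue_tuple (n : nat) :
    {sigma_finite_measure set (n.-tuple mR) -> \bar R} :=
  if n is n'.+1 then lebesgue_step (lebesgue_tuple n')
  else \d_([tuple] : 0.-tuple mR).

End LebesgueTuple.

Definition tuple_row (R : realType) (n : nat) (t : n.-tuple R) : 'rV[R]_n :=
  \row_(i < n) tnth t i.

Definition vol (R : realType) (n : nat) (A : set 'rV[R]_n) : \bar R :=
  lebesgue_tuple R n (@tuple_row R n @^-1` A).

(* Together with being a measure on the Borel sets, this determines [vol]. *)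
Lemma vol_box (R : realType) (n : nat) (a b : 'rV[R]_n) :
  (forall i, a 0 i <= b 0 i) ->
  vol [set x | forall i, a 0 i <= x 0 i <= b 0 i] =
  (\prod_(i < n) (b 0 i - a 0 i))%:E.
Proof.
move=> ab; rewrite /vol.
pose box k (u v : 'I_k -> R) : set (k.-tuple R) :=
  [set t | forall i, u i <= tnth t i <= v i].
have mbox k u v : measurable (box k u v : set (k.-tuple (measurableTypeR R))).
  rewrite (_ : box k u v = \big[setI/setT]_(i < k)
      ((@tnth k R ^~ i) @^-1` `[u i, v i]%classic)); last first.
    rewrite -bigcap_seq; apply/seteqP; split => t /=.
      by move=> ht i _ /=; rewrite in_itv/=; exact: ht.
    move=> ht i; have /= := ht i; rewrite in_itv/=; apply.
    by rewrite mem_index_enum.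
  apply: big_rec => [|i A _ mA]; first exact: measurableT.
  apply: measurableI => //.
  by rewrite -[X in measurable X]setTI; apply: measurable_tnth => //;
    exact: measurable_itv.
have main k u v : (forall i, u i <= v i) ->
    lebesgue_tuple R k (box k u v) = (\prod_(i < k) (v i - u i))%:E.
  elim: k u v => [|k IH] u v uv.
    rewrite big_ord0 /= diracE mem_set//=.
    by case.
  rewrite big_ord_recl /= /lebesgue_step /pushforward.
  rewrite (_ : _ @^-1` _ = `[u ord0, v ord0]%classic `*`
    box k (u \o lift ord0) (v \o lift ord0)); last first.
    apply/seteqP; split => -[x t] /=.
      move=> h; split => /=; first by rewrite in_itv/=; exact: (h ord0).
      by move=> i; have := h (lift ord0 i); rewrite /cons_pair/= tnthS.
    move=> [hx ht] i; case: (unliftP ord0 i) => [j ->|->].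
      by rewrite /cons_pair/= tnthS; exact: ht.
    by move: hx; rewrite in_itv.
  rewrite product_measure1E//; last exact: mbox.
  rewrite IH; last by move=> i; exact: uv.
  have := lebesgue_measure_itv `[u ord0, v ord0]%R; rewrite /= => ->.
  rewrite lte_fin; case: ltP => [_|vu]; first by rewrite -EFinD -EFinM.
  have -> : v ord0 = u ord0 by apply/eqP; rewrite eq_le vu uv.
  by rewrite subrr mul0e mul0r.
rewrite -main//; congr (lebesgue_tuple R n _).
by apply/seteqP; split => t h i; have := h i; rewrite /tuple_row mxE.
Qed.

(* Main.v *)
Require Import Defs.
From HB Require Import structures.
From mathcomp Require Import all_boot all_order all_algebra.
From mathcomp Require Import all_classical all_reals all_analysis.
From mathcomp Require Import measurable_realfun ring lra.

Set Implicit Arguments.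
Unset Strict Implicit.
Unset Printing Implicit Defensive.

Import Order.TTheory GRing.Theory Num.Theory.
Import numFieldNormedType.Exports.

Local Open Scope classical_set_scope.
Local Open Scope ring_scope.

(* Write x+ and x- for the positive and negative parts of x.  The body is
   M = {x : |x+|^2 + (|x-| + sqrt 2)^2 <= 4}.  Let u be a unit vector with
   p = |u+| and q = |u-|.  If p <= q then <x, u> ranges over
   [- sqrt 2 q, 2 - sqrt 2 q] when x runs through M; the case q <= p follows by
   replacing u with -u.  Hence M has constant width 2.

   For the volume, stretching each orthant shows that
   E(A, B) = {x : |x+|^2 / A^2 + |x-|^2 / B^2 <= 1} has volume
   ((A + B) / 2)^n Vol(B^n), since its part in an orthant with k positive
   coordinates has volume A^k B^(n-k) 2^-n Vol(B^n).  A single E(A, B) that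
   contains M has A >= sqrt 2 and B >= 2 - sqrt 2, so A + B >= 2, but M is covered
   by three of them with A + B <= 539/300 < 2 * 0.9. *)

(** * Euclidean inner product and norm *)

Section EuclideanNorm.
Context (R : realType) (n : nat).
Implicit Types (x y u : 'rV[R]_n) (a : R).

Lemma dotpC x y : dotp x y = dotp y x.
Proof. by apply: eq_bigr => i _; rewrite mulrC. Qed.

Lemma dotpDl x y u : dotp (x + y) u = dotp x u + dotp y u.
Proof. by rewrite -big_split/=; apply: eq_bigr => i _; rewrite mxE mulrDl. Qed.

Lemma dotpZl a x u : dotp (a *: x) u = a * dotp x u.
Proof. by rewrite mulr_sumr; apply: eq_bigr => i _; rewrite mxE mulrA. Qed.

Lemma dotpNl x u : dotp (- x) u = - dotp x u.
Proof. by rewrite -scaleN1r dotpZl mulN1r. Qed.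

Lemma dotpDr x y u : dotp u (x + y) = dotp u x + dotp u y.
Proof. by rewrite dotpC dotpDl !(dotpC u). Qed.

Lemma dotpZr a x u : dotp u (a *: x) = a * dotp u x.
Proof. by rewrite dotpC dotpZl (dotpC u). Qed.

Lemma dotpNr x u : dotp u (- x) = - dotp u x.
Proof. by rewrite dotpC dotpNl dotpC. Qed.

Lemma dotp_ge0 x : 0 <= dotp x x.
Proof. by apply: sumr_ge0 => i _; rewrite -expr2 sqr_ge0. Qed.

Lemma enorm_ge0 x : 0 <= enorm x. Proof. exact: sqrtr_ge0. Qed.

Lemma sqr_enorm x : enorm x ^+ 2 = dotp x x.
Proof. by rewrite sqr_sqrtr// dotp_ge0. Qed.

Lemma enorm_eq0_coord x i : enorm x = 0 -> x 0 i = 0.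
Proof.
move=> x0; have := sqr_enorm x; rewrite x0 expr0n/= => /esym/eqP.
rewrite psumr_eq0 => [/allP/(_ i)|j _]; last by rewrite -expr2 sqr_ge0.
by rewrite mem_index_enum => /(_ isT); rewrite -expr2 sqrf_eq0 => /eqP.
Qed.

(** Cauchy-Schwarz: expanding the square of |y| x - |x| y gives 2 |x| |y| (|x| |y| - <x, y>) >= 0.
    Vanishing norms are treated first so that the factor |x| |y| can be cancelled. *)
Lemma dotp_le_enorm x y : dotp x y <= enorm x * enorm y.
Proof.
have [x0|x0] := eqVneq (enorm x) 0.
  by rewrite x0 mul0r /dotp big1// => i _; rewrite enorm_eq0_coord// mul0r.
have [y0|y0] := eqVneq (enorm y) 0.
  by rewrite y0 mulr0 /dotp big1// => i _; rewrite (enorm_eq0_coord _ y0) mulr0.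
have xy0 : 0 < enorm x * enorm y by rewrite mulr_gt0// lt0r enorm_ge0 andbT.
have := dotp_ge0 (enorm y *: x - enorm x *: y).
rewrite !(dotpDl, dotpDr, dotpNl, dotpNr, dotpZl, dotpZr) -!sqr_enorm.
rewrite (dotpC y x); nra.
Qed.

Lemma enormZ a x : 0 <= a -> enorm (a *: x) = a * enorm x.
Proof.
by move=> a0; rewrite /enorm dotpZl dotpZr mulrA -expr2 sqrtrM ?sqr_ge0//
  sqrtr_sqr ger0_norm.
Qed.

Lemma enorm0 : enorm (0 : 'rV[R]_n) = 0.
Proof. by rewrite -(scale0r 0) enormZ// mul0r. Qed.

Lemma enormN x : enorm (- x) = enorm x.
Proof. by rewrite /enorm dotpNl dotpNr opprK. Qed.

Lemma enormD x y : enorm (x + y) <= enorm x + enorm y.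
Proof.
rewrite -(ler_pXn2r (n := 2))// ?nnegrE ?addr_ge0 ?enorm_ge0//.
rewrite sqr_enorm dotpDl !dotpDr -!sqr_enorm (dotpC y x).
have := dotp_le_enorm x y; nra.
Qed.

(** * Positive and negative parts, with x- encoded as [pos_part (- x)] *)

Definition pos_part x : 'rV[R]_n := map_mx (fun t => Num.max t 0) x.

Lemma pos_part_ge0 x i : 0 <= pos_part x 0 i.
Proof. by rewrite mxE le_max lexx orbT. Qed.

Lemma pos_part_eq0 x : (forall i, 0 <= x 0 i) -> pos_part (- x) = 0.
Proof. by move=> x0; apply/rowP => i; rewrite !mxE max_r// oppr_le0. Qed.

Lemma pos_part_sub x : pos_part x - pos_part (- x) = x.
Proof.
by apply/rowP => i; rewrite !mxE; case: (leP (x 0 i) 0); case: (leP (- x 0 i) 0);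
  lra.
Qed.

Lemma pos_part_mul x i : pos_part x 0 i * pos_part (- x) 0 i = 0.
Proof.
rewrite !mxE; case: (leP (x 0 i) 0) => [|x0]; first by rewrite mul0r.
by rewrite max_r ?mulr0// oppr_le0 ltW.
Qed.

Lemma dotp_pos_part x : dotp (pos_part x) (pos_part (- x)) = 0.
Proof. by rewrite /dotp big1// => i _; exact: pos_part_mul. Qed.

Lemma pos_part_subr_disjoint x y :
  (forall i, 0 <= x 0 i) -> (forall i, 0 <= y 0 i) ->
  (forall i, x 0 i * y 0 i = 0) -> pos_part (x - y) = x.
Proof.
move=> x0 y0 xy; apply/rowP => i; rewrite !mxE.
have /eqP := xy i; rewrite mulf_eq0 => /orP[]/eqP xi0; rewrite xi0.
  by rewrite sub0r max_r// oppr_le0.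
by rewrite subr0 max_l.
Qed.

Lemma sqr_enorm_pos_part x :
  enorm (pos_part x) ^+ 2 + enorm (pos_part (- x)) ^+ 2 = enorm x ^+ 2.
Proof.
rewrite -[in RHS](pos_part_sub x) !sqr_enorm.
rewrite !(dotpDl, dotpDr, dotpNl, dotpNr) (dotpC (pos_part (- x))).
by rewrite dotp_pos_part; ring.
Qed.

(** The cross terms <x+, u-> and <x-, u+> are nonnegative and enter <x, u> with a minus sign.
    Dropping them leaves two products for Cauchy-Schwarz. *)
Lemma dotp_le_pos_part x u : dotp x u <= enorm (pos_part x) * enorm (pos_part u)
  + enorm (pos_part (- x)) * enorm (pos_part (- u)).
Proof.
apply: le_trans (lerD (dotp_le_enorm _ _) (dotp_le_enorm _ _)).
rewrite -big_split/=; apply: ler_sum => i _.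
have ge0 z := pos_part_ge0 z i.
have := ge0 x; have := ge0 (- x); have := ge0 u; have := ge0 (- u).
have sub (z : 'rV[R]_n) : z 0 i = pos_part z 0 i - pos_part (- z) 0 i.
  by rewrite -[in LHS](pos_part_sub z) !mxE.
rewrite (sub x) (sub u); nra.
Qed.

(** The positive part is subadditive in each coordinate, and the norm is monotone on nonnegative
    vectors. This makes x |-> |x-| convex. *)
Lemma enorm_pos_partD x y :
  enorm (pos_part (x + y)) <= enorm (pos_part x) + enorm (pos_part y).
Proof.
apply: le_trans (enormD _ _); apply: ler_wsqrtr; apply: ler_sum => i _.
have ge0 z := pos_part_ge0 z i.
rewrite -!expr2 ler_pXn2r ?nnegrE ?ge0//.
  rewrite !mxE ge_max lerD ?le_max ?lexx//=; have := ge0 x; have := ge0 y.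
  by rewrite !mxE; lra.
by rewrite mxE addr_ge0 ?ge0.
Qed.

Lemma pos_partZ a x : 0 <= a -> pos_part (a *: x) = a *: pos_part x.
Proof. by move=> a0; apply/rowP => i; rewrite !mxE maxr_pMr// mulr0. Qed.

Lemma sqr_enorm_convex (t : R) x y : 0 <= t -> t <= 1 ->
  enorm (t *: x + (1 - t) *: y) ^+ 2
    <= t * enorm x ^+ 2 + (1 - t) * enorm y ^+ 2.
Proof.
move=> t0 t1; have := dotp_ge0 (x - y); rewrite !sqr_enorm.
rewrite !(dotpDl, dotpDr, dotpNl, dotpNr, dotpZl, dotpZr) (dotpC y x) => h.
have : 0 <= t * (1 - t) * (dotp x x - dotp x y + (- dotp x y - - dotp y y)).
  by apply: mulr_ge0 => //; apply: mulr_ge0 => //; lra.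
nra.
Qed.

Lemma continuous_enorm_pos_part : continuous (fun x => enorm (pos_part x)).
Proof.
move=> x; apply: (@continuous_comp _ _ _
  (fun x => dotp (pos_part x) (pos_part x)) Num.sqrt); last first.
  exact: sqrt_continuous.
have h i : {for x, continuous (fun y : 'rV[R]_n => Num.max (y 0 i) 0)}.
  apply: (@continuous_max R _ (fun y : 'rV[R]_n => y 0 i) (cst 0)).
    exact: coord_continuous.
  exact: cst_continuous.
apply: (@cvg_big _ _ +%R 0 xpredT _ _ (nbhs x)) => [|i _].
  exact: add_continuous.
rewrite !mxE (_ : (fun _ => _) = (fun y : 'rV[R]_n => Num.max (y 0 i) 0 *
  Num.max (y 0 i) 0)); last by apply/funext => y; rewrite !mxE.
exact: (cvgM (h i) (h i)).
Qed.

End EuclideanNorm.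

(** * The body M: convexity, compactness and constant width *)

Section Body.
Context (R : realType) (n : nat).
Implicit Types (x y u : 'rV[R]_n).
Local Notation r2 := (Num.sqrt (2 : R)).

(** This is |x+|^2 + (|x-| + sqrt 2)^2 <= 4 expanded, with |x+|^2 + |x-|^2 merged into |x|^2. The
    left side is then visibly a sum of convex functions. *)
Definition small_body : set 'rV[R]_n :=
  [set x | enorm x ^+ 2 + 2 * r2 * enorm (pos_part (- x)) <= 2].

Lemma sqrt2_gt0 : 0 < r2. Proof. by rewrite sqrtr_gt0. Qed.

Lemma sqr_sqrt2 : r2 ^+ 2 = 2. Proof. by rewrite sqr_sqrtr. Qed.

Lemma small_body_convex (t : R) x y : 0 <= t -> t <= 1 ->
  small_body x -> small_body y -> small_body (t *: x + (1 - t) *: y).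
Proof.
move=> t0 t1; rewrite /small_body /= => xM yM.
have t1' : 0 <= 1 - t by lra.
have := sqr_enorm_convex x y t0 t1.
have : enorm (pos_part (- (t *: x + (1 - t) *: y)))
    <= t * enorm (pos_part (- x)) + (1 - t) * enorm (pos_part (- y)).
  rewrite opprD -!scalerN; apply: le_trans (enorm_pos_partD _ _) _.
  by rewrite !pos_partZ// !enormZ.
have := sqrt2_gt0.
move: (enorm (pos_part (- (t *: x + (1 - t) *: y)))) => c.
move: (enorm (t *: x + (1 - t) *: y) ^+ 2) => d r0 /(ler_wpM2l (ltW r0)).
nra.
Qed.

Lemma continuous_small_body : continuous
  (fun x => enorm x ^+ 2 + 2 * r2 * enorm (pos_part (- x))).
Proof.
have c1 := @continuous_enorm_pos_part R n.
have oc : continuous (fun x : 'rV[R]_n => - x) by exact: opp_continuous.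
have c2 : continuous (fun x : 'rV[R]_n => enorm (pos_part (- x))).
  by move=> x; exact (@continuous_comp _ _ _ _ _ _ (oc x) (c1 (- x))).
(* Splitting |x|^2 back into |x+|^2 + |x-|^2 leaves only functions already known to be
   continuous. *)
under eq_fun do rewrite -sqr_enorm_pos_part !expr2.
move=> x; exact: (cvgD (cvgD (cvgM (c1 x) (c1 x)) (cvgM (c2 x) (c2 x)))
  (cvgM (cvg_cst _) (c2 x))).
Qed.

Lemma norm_coord_le_enorm x i : `|x 0 i| <= enorm x.
Proof.
rewrite -sqrtr_sqr; apply: ler_wsqrtr; rewrite /dotp (bigD1 i)//= -expr2 lerDl.
by apply: sumr_ge0 => j _; rewrite -expr2 sqr_ge0.
Qed.

Lemma convex_body_small_body : convex_body small_body.
Proof.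
split.
- apply: bounded_closed_compact.
    exists 2; split; first exact: num_real.
    move=> M M2 x; rewrite /small_body/= => xM.
    rewrite /Num.norm/= mx_normrE; apply: bigmax_le => [|[i j] _ /=]; first lra.
    rewrite ord1; apply: le_trans (norm_coord_le_enorm _ _) _.
    have := enorm_ge0 x; have := enorm_ge0 (pos_part (- x)).
    have := sqrt2_gt0; nra.
  apply: (@preimage_closed _ _ _ [set a : R | a <= 2]).
    by move=> x _; exact: continuous_small_body.
  exact: closed_le.
- move=> x y t /set_mem xM /set_mem yM; apply/mem_set.
  by apply: small_body_convex.
- have p0 : pos_part (- 0) = 0 :> 'rV[R]_n.
    by apply: pos_part_eq0 => i; rewrite mxE.
  have : nbhs (0 : 'rV[R]_n)
      ((fun x => enorm x ^+ 2 + 2 * r2 * enorm (pos_part (- x)))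
         @^-1` [set a | a < 2]).
    apply: continuous_small_body; rewrite /= p0 enorm0 expr0n/= mulr0 addr0.
    by apply: open_nbhs_nbhs; split => /=; [exact: open_lt|exact: ltr0n].
  by move=> h; exists 0; apply: filterS h => x /ltW.
Qed.

(* With a = |x+|, b = |x-|, the bound a p + b q <= 2 - sqrt 2 q is the
   Cauchy-Schwarz inequality for (a, b + sqrt 2), of norm at most 2, and the
   unit vector (p, q). *)
Lemma small_body_dotp_le x u : small_body x -> enorm u = 1 ->
  dotp x u <= 2 - r2 * enorm (pos_part (- u)).
Proof.
rewrite /small_body/= -sqr_enorm_pos_part => xM u1.
apply: le_trans (dotp_le_pos_part _ _) _.
have := sqr_enorm_pos_part u; rewrite u1 expr1n.
move: xM (enorm_ge0 (pos_part x)) (enorm_ge0 (pos_part (- x))).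
move: (enorm_ge0 (pos_part u)) (enorm_ge0 (pos_part (- u))).
move: (enorm (pos_part x)) (enorm (pos_part (- x))) => a b.
move: (enorm (pos_part u)) (enorm (pos_part (- u))) => p q.
move: sqrt2_gt0 sqr_sqrt2; move: r2 => r.
move=> r0 r2 p0 q0 xM a0 b0 pq.
have : a ^+ 2 + (b + r) ^+ 2 <= 4 by lra.
have := sqr_ge0 (a - 2 * p); have := sqr_ge0 (b + r - 2 * q); nra.
Qed.

(** With a = |x+|, b = |x-| and p <= q, the product <x, -u> is at most a q + b p <= (a + b) q, so it
    suffices that a + b <= sqrt 2 on M. *)
Lemma small_body_dotp_ge x u :
  enorm (pos_part u) <= enorm (pos_part (- u)) -> small_body x ->
  - (r2 * enorm (pos_part (- u))) <= dotp x u.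
Proof.
move=> pq; rewrite /small_body/= -sqr_enorm_pos_part => xM.
rewrite lerNl -dotpNr; apply: le_trans (dotp_le_pos_part _ _) _; rewrite opprK.
move: xM pq (enorm_ge0 (pos_part x)) (enorm_ge0 (pos_part (- x))).
move: (enorm_ge0 (pos_part u)).
move: (enorm (pos_part x)) (enorm (pos_part (- x))) => a b.
move: (enorm (pos_part u)) (enorm (pos_part (- u))) => p q.
move: sqrt2_gt0 sqr_sqrt2; move: r2 => r r0 r2 p0 xM pq a0 b0.
(* Membership in M gives a^2 <= 2 - 2 r b - b^2, which is at most (r - b)^2 because r^2 = 2. *)
have abr : a + b <= r.
  have br : b <= r by nra.
  have : a ^+ 2 <= (r - b) ^+ 2 by nra.
  by rewrite ler_pXn2r ?nnegrE//; lra.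
have : b * p <= b * q by exact: ler_wpM2l.
have : (a + b) * q <= r * q by apply: ler_wpM2r => //; lra.
lra.
Qed.

Lemma small_body_dotp_extrema u : enorm u = 1 ->
  enorm (pos_part u) <= enorm (pos_part (- u)) ->
  (exists2 x, small_body x & dotp x u = 2 - r2 * enorm (pos_part (- u))) /\
  (exists2 x, small_body x & dotp x u = - (r2 * enorm (pos_part (- u)))).
Proof.
move=> u1; have := sqr_enorm_pos_part u; rewrite u1 expr1n.
have := enorm_ge0 (pos_part u); have := enorm_ge0 (pos_part (- u)).
have ge0 := @pos_part_ge0 R n; have disj := pos_part_mul u.
set p := enorm (pos_part u); set q := enorm (pos_part (- u)) => q0 p0 pq1 pq.
have qq : dotp (pos_part (- u)) u = - q ^+ 2.
  rewrite -[X in dotp _ X](pos_part_sub u) dotpDr dotpNr dotpC dotp_pos_part.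
  by rewrite add0r -sqr_enorm.
have pp : dotp (pos_part u) u = p ^+ 2.
  rewrite -[X in dotp _ X](pos_part_sub u) dotpDr dotpNr dotp_pos_part subr0.
  by rewrite -sqr_enorm.
move: sqrt2_gt0 sqr_sqrt2; rewrite /small_body/=; move: r2 => r r0 r2.
have qgt0 : 0 < q by nra.
(* From p <= q and p^2 + q^2 = 1 follows q^2 >= 1/2. *)
have rq : 1 <= r * q.
  rewrite -(ler_pXn2r (n := 2)) ?nnegrE ?mulr_ge0 ?(ltW r0)//.
  by rewrite expr1n exprMn r2; nra.
split.
  (* Equality in Cauchy-Schwarz requires (|x+|, |x-| + r) = 2 (p, q), with x+ and x- along u+ and
     u-. Hence x+ = 2 u+ and x- = c u- with c q = 2 q - r; the bound r q >= 1 makes c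
     nonnegative. *)
  pose c := 2 - r / q.
  have c0 : 0 <= c.
    by rewrite subr_ge0 ler_pdivrMr// -r2 expr2 -mulrA ler_peMr// ltW.
  have cq : c * q = 2 * q - r by rewrite mulrBl divfK// gt_eqF.
  exists (2 *: pos_part u - c *: pos_part (- u)).
    rewrite -sqr_enorm_pos_part pos_part_subr_disjoint; last first.
    - by move=> i; rewrite mxE [X in _ * X]mxE mulrACA disj mulr0.
    - by move=> i; rewrite mxE mulr_ge0.
    - by move=> i; rewrite mxE mulr_ge0.
    rewrite opprB pos_part_subr_disjoint; last first.
    - by move=> i; rewrite mxE [X in _ * X]mxE mulrACA [X in _ * X]mulrC disj mulr0.
    - by move=> i; rewrite mxE mulr_ge0.
    - by move=> i; rewrite mxE mulr_ge0.
    by rewrite !enormZ// -/p -/q cq; nra.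
  rewrite dotpDl dotpNl !dotpZl pp qq mulrN opprK [q ^+ 2]expr2 [c * _]mulrA cq; nra.
(* The lower bound is attained with |x+| = r and x- = 0, where x+ points along u-. *)
have rq0 : 0 <= r / q by rewrite divr_ge0// ltW.
exists ((r / q) *: pos_part (- u)).
  rewrite (@pos_part_eq0 _ _ (_ *: _)); last by move=> i; rewrite mxE mulr_ge0.
  by rewrite enorm0 mulr0 addr0 enormZ// -/q divfK ?gt_eqF// r2.
by rewrite dotpZl qq mulrN expr2 mulrA divfK// gt_eqF.
Qed.

(** Replacing u by -u reflects the interval, so p <= q may be assumed. The two extreme values then
    differ by 2, and convexity of M fills the gap. *)
Lemma dotp_image_small_body u : enorm u = 1 ->
  exists c, [set dotp x u | x in small_body] = `[c, c + 2]%classic.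
Proof.
wlog pq : u / enorm (pos_part u) <= enorm (pos_part (- u)) => [wlg|] u1.
  have [|qp] := leP (enorm (pos_part u)) (enorm (pos_part (- u))).
    by move=> /wlg; apply.
  have [||c E] := wlg (- u); rewrite ?opprK ?enormN ?ltW//.
  exists (- (c + 2)); apply/seteqP; split=> [v [x xM <-]|v /= vc].
    have : `[c, c + 2]%classic (dotp x (- u)) by rewrite -E; exists x.
    by rewrite /= !in_itv/= dotpNr; lra.
  have : `[c, c + 2]%classic (- v) by move: vc; rewrite /= !in_itv/=; lra.
  rewrite -E => -[x xM]; rewrite dotpNr => /oppr_inj <-; by exists x.
have [[x1 x1M d1] [x2 x2M d2]] := small_body_dotp_extrema u1 pq.
exists (- (r2 * enorm (pos_part (- u)))); apply/seteqP; split=> v /=.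
  move=> [x xM <-]; rewrite in_itv/= small_body_dotp_ge//.
  by have := small_body_dotp_le xM u1; lra.
(* The denominator 2 is <x1, u> - <x2, u>, so this t interpolates to the value v. *)
rewrite in_itv/= => /andP[v1 v2]; pose t := (v - dotp x2 u) / 2.
exists (t *: x1 + (1 - t) *: x2).
  by apply: small_body_convex => //; rewrite /t d2; lra.
by rewrite dotpDl !dotpZl /t d1 d2; lra.
Qed.

Lemma constant_width_small_body : constant_width 2 small_body.
Proof.
move=> p u u1; have [c E] := dotp_image_small_body u1.
(* The projection of x has parameter <x, u> - <p, u> on the line, so the parameter set is a
   translate of the interval of values <x, u>. *)
rewrite /length_on_line (_ : _ @^-1` _ =
    `[c - dotp p u, c - dotp p u + 2]%classic).
  have := @lebesgue_measure_itv R `[c - dotp p u, c - dotp p u + 2].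
  by rewrite /= => ->; rewrite lte_fin ltrDl ltr0n -EFinB addrAC subrr add0r.
have uu : dotp u u = 1 by rewrite -sqr_enorm u1 expr1n.
have lineK (s t : R) : p + s *: u = p + t *: u -> s = t.
  by move=> /addrI/(congr1 (@dotp R n ^~ u)); rewrite !dotpZl uu !mulr1.
apply/seteqP; split=> t /=.
  move=> [x xM] /lineK <-; have : `[c, c + 2]%classic (dotp x u).
    by rewrite -E; exists x.
  by rewrite /= !in_itv/= dotpDl dotpNl; lra.
rewrite in_itv/= => tc; have : `[c, c + 2]%classic (t + dotp p u).
  by rewrite /= in_itv/=; lra.
rewrite -E => -[x xM xt]; exists x => //.
by rewrite /orth_proj /line dotpDl dotpNl xt addrK.
Qed.

End Body.

(** * Volume of E(A, B), one coordinate at a time *)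

Section Gauge.
Context (R : realType).
Local Notation mR := (measurableTypeR R).
Implicit Types (A B c : R).

(** The contribution of one coordinate to |x+|^2 / A^2 + |x-|^2 / B^2. *)
Definition gauge A B (x : mR) : mR :=
  (Num.max x 0 / A) ^+ 2 + (Num.max (- x) 0 / B) ^+ 2.

Lemma measurable_gauge A B : measurable_fun [set: mR] (gauge A B).
Proof.
apply: measurable_funD.
  by apply/measurable_funX/measurable_funM => //; apply: measurable_maxr.
by apply/measurable_funX/measurable_funM => //; apply: measurable_maxr => //;
  exact: measurableT_comp.
Qed.

Lemma gauge_preimage_ray A B c : 0 < A -> 0 < B ->
  gauge A B @^-1` `]-oo, c[%classic =
    `]- (B * Num.sqrt c), A * Num.sqrt c[%classic.
Proof.
move=> A0 B0; have sqr_lt (z : R) : 0 <= z -> (z ^+ 2 < c) = (z < Num.sqrt c).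
  move=> z0; rewrite -{2}(ger0_norm z0) -sqrtr_sqr.
  have [c0|c0] := ltP 0 c; first by rewrite ltr_sqrt.
  (* For c <= 0 the root is 0 by convention, and both comparisons are false. *)
  rewrite [Num.sqrt c]ler0_sqrtr// ltNge (le_trans c0) ?sqr_ge0//.
  by rewrite ltNge sqrtr_ge0.
apply/seteqP; split=> x; rewrite /= !in_itv/= /gauge.
  have [x0|x0] := leP x 0.
    rewrite mul0r expr0n add0r max_l ?oppr_ge0// sqr_lt; last first.
      by rewrite divr_ge0 ?oppr_ge0// ltW.
    rewrite ltr_pdivrMr// => h; rewrite ltrNl mulrC h/=.
    have [s0|s0] := ltP 0 (Num.sqrt c).
      by apply: le_lt_trans x0 _; rewrite mulr_gt0.
    have : - x < 0 by apply: lt_le_trans h _; rewrite pmulr_lle0.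
    lra.
  rewrite max_r ?oppr_le0 ?ltW// mul0r expr0n addr0 sqr_lt; last first.
    by rewrite divr_ge0// ltW.
  rewrite ltr_pdivrMr// => h; rewrite [A * _]mulrC h andbT.
  have s0 : 0 < Num.sqrt c by rewrite -(pmulr_lgt0 _ A0) (lt_trans x0).
  by rewrite (lt_trans _ x0)// oppr_lt0 mulr_gt0.
move=> /andP[h1 h2]; have [x0|x0] := leP x 0.
  rewrite mul0r expr0n add0r max_l ?oppr_ge0// sqr_lt; last first.
    by rewrite divr_ge0 ?oppr_ge0// ltW.
  by rewrite ltr_pdivrMr// ltrNl mulrC.
rewrite max_r ?oppr_le0 ?ltW// mul0r expr0n addr0 sqr_lt; last first.
  by rewrite divr_ge0// ltW.
by rewrite ltr_pdivrMr// mulrC.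
Qed.

(** The length depends on A and B only through the factor A + B, which is the source of the ratio (A
    + B) / 2 to the case A = B = 1. *)
Lemma lebesgue_gauge_ray A B c : 0 < A -> 0 < B ->
  pushforward lebesgue_measure (gauge A B) `]-oo, c[%classic =
    ((A + B) * Num.sqrt c)%:E.
Proof.
move=> A0 B0; rewrite /pushforward gauge_preimage_ray//.
have := @lebesgue_measure_itv R `]- (B * Num.sqrt c), A * Num.sqrt c[.
rewrite /= => ->; rewrite lte_fin -EFinB; case: ltP => [_|].
  by congr EFin; ring.
have := sqrtr_ge0 c; move: (Num.sqrt c) => s s0 AB.
suff -> : (A + B) * s = 0 by [].
nra.
Qed.

(* Rays suffice since they form a pi-system generating the Borel sets. *)
Lemma lebesgue_gauge A B (S : set mR) : 0 < A -> 0 < B -> measurable S ->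
  pushforward lebesgue_measure (gauge A B) S =
  (((A + B) / 2)%:E * pushforward lebesgue_measure (gauge 1 1) S)%E.
Proof.
move=> A0 B0 mS; have k0 : 0 <= (A + B) / 2 by rewrite divr_ge0// addr_ge0// ltW.
pose k := NngNum k0.
have mA := measurable_gauge A B.
have m1 := measurable_gauge 1 1.
pose muA := [the {measure set mR -> \bar R} of
  @pushforward _ _ mR mR R lebesgue_measure (gauge A B)].
pose mu1 := [the {measure set mR -> \bar R} of
  @pushforward _ _ mR mR R lebesgue_measure (gauge 1 1)].
suff : muA mA S = [the {measure set mR -> \bar R} of mscale k (mu1 m1)] S by [].
apply: (@measure_unique _ R mR (@RGenInftyO.G R)
  (fun n => `]-oo, n%:R[%classic)) => //.
- exact: RGenInftyO.measurableE.
- move=> _ _ [x ->] [y ->]; exists (Num.min x y).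
  by apply/seteqP; split=> z; rewrite /= !in_itv/= lt_min => /andP.
- by move=> n; exists n%:R.
- apply/seteqP; split=> // x _; exists (Num.bound `|x|) => //=.
  by rewrite in_itv/= (le_lt_trans (ler_norm x))// archi_boundP.
- move=> _ [c ->]; rewrite /= /mscale/= !lebesgue_gauge_ray//.
  by rewrite -EFinM; congr EFin; field.
- by move=> n; rewrite /= lebesgue_gauge_ray// ltry.
Qed.

(** For c = 1 this is E(A, B). The level c is left free, possibly negative, because slicing lowers
    it. *)
Definition gauge_ball A B n (c : R) : set (n.-tuple mR) :=
  [set t | \sum_(i < n) gauge A B (tnth t i) <= c].

Lemma measurable_gauge_ball A B n c : measurable (@gauge_ball A B n c).
Proof.
rewrite -[X in measurable X]setTI; apply: measurable_fun_le => //.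
apply: measurable_sum => i; apply: measurableT_comp (measurable_tnth _).
exact: measurable_gauge.
Qed.

Lemma xsection_gauge_ball A B n c (x : mR) :
  xsection (@cons_pair R n @^-1` gauge_ball A B c) x =
    gauge_ball A B (c - gauge A B x).
Proof.
have E t : \sum_(i < n.+1) gauge A B (tnth (cons_pair (x, t)) i) =
    \sum_(i < n) gauge A B (tnth t i) + gauge A B x.
  rewrite big_ord_recl addrC; congr (_ + _).
  by apply: eq_bigr => i _; rewrite /cons_pair/= tnthS.
by apply/seteqP; split=> t; rewrite /xsection/= inE /gauge_ball/= E lerBrDr.
Qed.

(** Induction by slices, in place of a sum over orthants. By the induction hypothesis the slice at x
    has volume ((A + B) / 2)^n [W] ([gauge A B x]), which sees x only through its gauge. The
    integral is thus over the image measure of the gauge, and changing A, B to 1, 1 there yields one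
    more factor (A + B) / 2. *)
Lemma lebesgue_gauge_ball A B n c : 0 < A -> 0 < B ->
  (lebesgue_tuple R n (gauge_ball A B c) =
   (((A + B) / 2) ^+ n)%:E * lebesgue_tuple R n (gauge_ball 1 1 c))%E.
Proof.
move=> A0 B0; have k0 : 0 <= (A + B) / 2 by rewrite divr_ge0// addr_ge0// ltW.
elim: n c => [|n IH] c.
  rewrite expr0 mul1e; congr (lebesgue_tuple R 0 _).
  by apply/seteqP; split => t; rewrite /gauge_ball/= !big_ord0.
pose W y := lebesgue_tuple R n (gauge_ball 1 1 (c - y)).
have mW : measurable_fun [set: mR] W.
  (* [W] y is the measure of the section of [Q] at y, so its measurability follows from that of
     [Q]. *)
  pose Q : set (mR * n.-tuple mR) :=
    [set p | \sum_(i < n) gauge 1 1 (tnth p.2 i) <= c - p.1].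
  have mQ : measurable Q.
    rewrite -[X in measurable X]setTI; apply: measurable_fun_le => //.
      apply: measurable_sum => i.
      apply: (measurableT_comp (measurable_gauge _ _)).
      by apply: (measurableT_comp (measurable_tnth _)); exact: measurable_snd.
    by apply: measurable_funB => //; exact: measurable_fst.
  rewrite (_ : W = lebesgue_tuple R n \o xsection Q).
    exact: measurable_fun_xsection.
  apply/funext => y; rewrite /W/=; congr (lebesgue_tuple R n _).
  by apply/seteqP; split=> t; rewrite /xsection/= inE.
have step a b : lebesgue_tuple R n.+1 (gauge_ball a b c) =
    (\int[lebesgue_measure]_x
      lebesgue_tuple R n (gauge_ball a b (c - gauge a b x)))%E.
  rewrite /= /lebesgue_step /pushforward /product_measure1.
  by apply: eq_integral => x _ /=; rewrite xsection_gauge_ball.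
rewrite !step.
transitivity (\int[pushforward lebesgue_measure (gauge A B)]_x
    ((((A + B) / 2) ^+ n)%:E * W x))%E.
  rewrite ge0_integral_pushforward//.
  - by apply: eq_integral => x _; rewrite IH.
  - exact: measurable_gauge.
  - exact: measurable_funeM.
  - by move=> x _; rewrite mule_ge0// lee_fin exprn_ge0.
pose k := NngNum k0.
have m1 := measurable_gauge 1 1.
pose mu1 := [the {measure set mR -> \bar R} of
  @pushforward _ _ mR mR R lebesgue_measure (gauge 1 1)].
have W0 x : (0 <= W x)%E by [].
transitivity (\int[mscale k (mu1 m1)]_x ((((A + B) / 2) ^+ n)%:E * W x))%E.
  apply: eq_measure_integral; first exact: measurable_gauge.
  by move=> mA S mS _; rewrite /= lebesgue_gauge.
rewrite ge0_integral_mscale//; last 2 first.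
- exact: measurable_funeM.
- by move=> x _; rewrite mule_ge0// lee_fin exprn_ge0.
rewrite ge0_integralZl//; last by rewrite lee_fin exprn_ge0.
by rewrite ge0_integral_pushforward// muleA -EFinM exprS.
Qed.

End Gauge.

(** * Volume of M by a covering with three sets E(A, B) *)

Section Volume.
Context (R : realType).
Local Notation mR := (measurableTypeR R).
Implicit Types (A B : R).

Lemma sum_gauge A B n (t : n.-tuple mR) :
  \sum_(i < n) gauge A B (tnth t i) =
    enorm (pos_part (tuple_row t)) ^+ 2 / A ^+ 2
    + enorm (pos_part (- tuple_row t)) ^+ 2 / B ^+ 2.
Proof.
rewrite !sqr_enorm big_split/= !mulr_suml; congr (_ + _);
  by apply: eq_bigr => i _; rewrite !mxE exprMn exprVn expr2.
Qed.

Lemma eball_preimage n :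
  @tuple_row R n @^-1` @eball R n = gauge_ball 1 1 1.
Proof.
apply/seteqP; split=> t; rewrite /eball /gauge_ball/= sum_gauge expr1n invr1;
  by rewrite !mulr1 sqr_enorm_pos_part expr_le1// enorm_ge0.
Qed.

Lemma measurable_small_body n :
  measurable (@tuple_row R n @^-1` @small_body R n : set (n.-tuple mR)).
Proof.
rewrite -[X in measurable X]setTI /small_body /preimage/=.
have mpos A B : measurable_fun setT
    (fun t : n.-tuple mR => \sum_(i < n) gauge A B (tnth t i)).
  apply: measurable_sum => i; apply: measurableT_comp (measurable_tnth _).
  exact: measurable_gauge.
(* [gauge 0 1] only sees the negative part, because x / 0 = 0. *)
rewrite (_ : [set t | _] = [set t : n.-tuple mR |
  \sum_(i < n) gauge 1 1 (tnth t i)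
  + 2 * Num.sqrt 2 * Num.sqrt (\sum_(i < n) gauge 0 1 (tnth t i)) <= 2]).
  apply: measurable_fun_le => //; apply: measurable_funD => //.
  apply: measurable_funM => //; apply: measurableT_comp => //.
  by apply: continuous_measurable_fun; exact: sqrt_continuous.
have E (t : n.-tuple mR) : Num.sqrt (\sum_(i < n) gauge 0 1 (tnth t i)) =
    enorm (pos_part (- tuple_row t)).
  rewrite sum_gauge expr0n/= invr0 mulr0 add0r expr1n invr1 mulr1.
  by rewrite sqrtr_sqr ger0_norm// enorm_ge0.
by apply/seteqP; split=> t /=; rewrite E sum_gauge expr1n invr1 !mulr1
  sqr_enorm_pos_part.
Qed.

Lemma measurable_box n (a b : 'rV[R]_n) :
  measurable (@tuple_row R n @^-1` [set x | forall i, a 0 i <= x 0 i <= b 0 i] :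
    set (n.-tuple mR)).
Proof.
rewrite (_ : _ @^-1` _ = \bigcap_(i in [set: 'I_n])
    ((@tnth n mR ^~ i) @^-1` `[a 0 i, b 0 i]%classic)).
  apply: fin_bigcap_measurable => [|i _]; first exact: finite_finset.
  rewrite -[X in measurable X]setTI; exact: measurable_tnth.
apply/seteqP; split=> t /= h i; first by move=> _; rewrite /= in_itv/=;
  have := h i; rewrite mxE.
by have := h i I; rewrite /= in_itv/= mxE.
Qed.

Lemma vol_le n (S T : set 'rV[R]_n) :
  measurable (@tuple_row R n @^-1` S : set (n.-tuple mR)) ->
  measurable (@tuple_row R n @^-1` T : set (n.-tuple mR)) ->
  S `<=` T -> (vol S <= vol T)%E.
Proof. by move=> mS mT ST; apply: le_measure; rewrite ?inE// => t /ST. Qed.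

Lemma measurable_eball n :
  measurable (@tuple_row R n @^-1` @eball R n : set (n.-tuple mR)).
Proof. by rewrite eball_preimage; exact: measurable_gauge_ball. Qed.

Lemma vol_eball_gt0 n : (0 < vol (@eball R n))%E.
Proof.
(* The cube [0, d]^n lies in the ball, since n d^2 <= n d <= 1; n + 1 keeps d positive and at most 1
   even for n = 0. *)
pose d : R := n.+1%:R^-1; have d0 : 0 < d by rewrite invr_gt0.
pose a : 'rV[R]_n := const_mx 0; pose b : 'rV[R]_n := const_mx d.
apply: (@lt_le_trans _ _ (vol [set x | forall i, a 0 i <= x 0 i <= b 0 i])).
  rewrite vol_box => [|i]; last by rewrite !mxE ltW.
  by rewrite lte_fin; apply: prodr_gt0 => i _; rewrite !mxE subr_gt0.
apply: vol_le; [exact: measurable_box|exact: measurable_eball|move=> x /= xab].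
rewrite /eball/= -(expr_le1 (n := 2))// ?enorm_ge0// sqr_enorm.
apply: (@le_trans _ _ (\sum_(i < n) d)).
  apply: ler_sum => i _; have := xab i; rewrite !mxE => /andP[x0 xd].
  apply: (@le_trans _ _ (d * 1)); last by rewrite mulr1.
  apply: ler_pM => //; apply: le_trans xd _.
  by rewrite invf_le1// ler1n.
rewrite sumr_const card_ord -mulr_natl ler_pdivrMr// mul1r ler_nat.
exact: leqnSn.
Qed.

Lemma vol_eball_lty n : (vol (@eball R n) < +oo)%E.
Proof.
pose a : 'rV[R]_n := const_mx (- 1); pose b : 'rV[R]_n := const_mx 1.
apply: (@le_lt_trans _ _ (vol [set x | forall i, a 0 i <= x 0 i <= b 0 i])).
  apply: vol_le; [exact: measurable_eball|exact: measurable_box|].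
  move=> x /= x1 i; rewrite !mxE -ler_norml.
  exact: le_trans (norm_coord_le_enorm _ _) x1.
by rewrite vol_box ?ltry// => i; rewrite !mxE; lra.
Qed.

(** Eliminating a^2 turns each condition into a quadratic inequality in b with positive leading
    coefficient, so on an interval of b it is enough to check the endpoints. The breakpoints are 0,
    21/100, 3/10 and 10/17. *)
Lemma three_ellipses (a b r : R) :
  0 <= a -> 0 <= b -> 0 <= r -> r ^+ 2 = 2 ->
  a ^+ 2 + b ^+ 2 + 2 * r * b <= 2 ->
  [\/ a ^+ 2 / (17 / 12) ^+ 2 + b ^+ 2 / (19 / 50) ^+ 2 <= 1,
      a ^+ 2 / (9 / 7) ^+ 2 + b ^+ 2 / (51 / 100) ^+ 2 <= 1
    | a ^+ 2 / (6 / 5) ^+ 2 + b ^+ 2 / (59 / 100) ^+ 2 <= 1].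
Proof.
(* 41/29 is a continued fraction convergent of sqrt 2 from below. *)
move=> a0 b0 r0 r2; have rge : 41 / 29 <= r by nra.
have : 41 / 29 * b <= r * b by exact: ler_wpM2r.
have : 0 <= a ^+ 2 by exact: sqr_ge0.
move: (a ^+ 2) => s s0 rb h.
have [b1|b1] := leP b (21 / 100); last have [b2|b2] := leP b (3 / 10).
(* In each case this product bounds b^2 by its chord over the interval, after which the claim is
   linear in b and a^2. *)
- constructor 1; have : 0 <= b * (21 / 100 - b) by apply: mulr_ge0 => //; lra.
  lra.
- constructor 2.
  have : 0 <= (b - 21 / 100) * (3 / 10 - b) by apply: mulr_ge0 => //; lra.
  lra.
- constructor 3; have b3 : b <= 10 / 17 by nra.
  have : 0 <= (b - 3 / 10) * (10 / 17 - b) by apply: mulr_ge0 => //; lra.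
  lra.
Qed.

Lemma lebesgue_gauge_ball_le A B k n : 0 < A -> 0 < B -> (A + B) / 2 <= k ->
  (lebesgue_tuple R n (gauge_ball A B 1) <= (k ^+ n)%:E * vol (@eball R n))%E.
Proof.
move=> A0 B0 ABk; rewrite lebesgue_gauge_ball// /vol eball_preimage.
rewrite lee_wpmul2r// lee_fin lerXn2r ?nnegrE// ?(le_trans _ ABk)//;
  by rewrite divr_ge0// addr_ge0// ltW.
Qed.

(** The 3 is the union bound; 539/600 is half of 17/12 + 19/50, the largest of the three sums A +
    B. *)
Lemma vol_small_body_le n :
  (vol (@small_body R n) <= (3 * (539 / 600) ^+ n)%:E * vol (@eball R n))%E.
Proof.
pose E A B : set (n.-tuple mR) := gauge_ball A B 1.
pose E1 := E (17 / 12) (19 / 50); pose E2 := E (9 / 7) (51 / 100).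
pose E3 := E (6 / 5) (59 / 100).
have mE A B : measurable (E A B) by exact: measurable_gauge_ball.
apply: (@le_trans _ _ (lebesgue_tuple R n (E1 `|` E2 `|` E3))).
  apply: le_measure; rewrite ?inE.
  - exact: measurable_small_body.
  - by do 2?apply: measurableU; exact: mE.
  - move=> t; rewrite /small_body/= -sqr_enorm_pos_part.
    move=> /(three_ellipses (enorm_ge0 _) (enorm_ge0 _) (ltW (sqrt2_gt0 R))
      (sqr_sqrt2 R)).
    rewrite /E1 /E2 /E3 /E /gauge_ball/= !sum_gauge.
    by case; [left; left|left; right|right].
apply: (le_trans (measureU2 _ (measurableU _ _ (mE _ _) (mE _ _)) (mE _ _))).
apply: (le_trans (leeD (measureU2 _ (mE _ _) (mE _ _)) (lexx _))).
rewrite EFinM -muleA; set V := ((_ ^+ n)%:E * _)%E.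
have -> : (3%:E * V = V + V + V)%E.
  have -> : 3 = 1 + 1 + 1 :> R by ring.
  by rewrite !EFinD !ge0_muleDl ?mul1e// -EFinD lee_fin.
by do 2?apply: leeD; apply: lebesgue_gauge_ball_le; lra.
Qed.

End Volume.

(** * Choice of n0 *)

Theorem theorem1 (R : realType) :
  exists n0 : nat, forall n : nat, (n0 <= n)%N ->
    exists M : set 'rV[R]_n,
      [/\ convex_body M, constant_width 2 M
        & (vol M < ((9 / 10) ^+ n)%:E * vol (@eball R n))%E].
Proof.
(* 539/540 is the ratio of 539/600 to 9/10; once its n-th power is below 1/3, it absorbs the factor
   3. *)
have q1 : `|539 / 540 : R| < 1 by rewrite ger0_norm; lra.
have /cvgr_lt/(_ (1 / 3)) : (GRing.exp (539 / 540 : R) : R ^nat) @ \oo --> 0.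
  exact: cvg_expr.
move=> /(_ ltac:(lra))[n0 _ small]; exists n0 => n n0n.
exists (@small_body R n); split.
- exact: convex_body_small_body.
- exact: constant_width_small_body.
apply: le_lt_trans (vol_small_body_le R n) _.
(* Cancelling Vol(B^n) from a strict inequality needs it positive and finite. *)
rewrite lte_pmul2r ?vol_eball_gt0 ?ge0_fin_numE ?vol_eball_lty//.
have := small n n0n; rewrite /= lte_fin => small_n.
have -> : 539 / 600 = 539 / 540 * (9 / 10) :> R by lra.
rewrite exprMn; have : 0 < (9 / 10 : R) ^+ n by rewrite exprn_gt0//; lra.
by move: small_n; move: (_ ^+ n) (_ ^+ n) => x y; nra.
Qed.
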